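(* Let $2\le N\le M$ and let $\hat\mu_{n,i}>0$ for $n\in\{1,\dots,N\}$, $i\in\{1,\dots,M\}$. Define $u_n(\boldsymbol a)=\hat\mu_{n,a_n}\eta_{a_n}(\boldsymbol a)$, $u_{n,\max}=\max_{\boldsymbol a}u_n(\boldsymbol a)$, assume $\sum_n u_n(\boldsymbol a)$ has a unique maximizer $\boldsymbol a^*$ with value $J_1$, and let $z^*$ be the state in which every player has baseline $\bar a_n=a^*_n$ and is content. Let $c>0$ satisfy $c>\sum_{n=1}^N u_{n,\max}-J_1$, and for $0<\varepsilon<1$ consider the Game of Thrones Markov chain $P^\varepsilon$ described in the context. Then for every $0<\eta<\frac12$ there exists $\varepsilon_0>0$ such that for every $0<\varepsilon<\varepsilon_0$, every stationary distribution $\pi$ of $P^\varepsilon$ satisfies $\pi(z^* )>\frac{1}{2(1-\eta)}$.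
   Context: For a strategy profile $\boldsymbol a\in\{1,\dots,M\}^N$ and arm $i$, $\eta_i(\boldsymbol a)=0$ if more than one player chose arm $i$, and $1$ otherwise. Game of Thrones (GoT) dynamics with parameters $\varepsilon\in(0,1)$ and $c>0$: the state is $z=(\bar a_n,S_n)_{n=1}^N$ where $\bar a_n\in\{1,\dots,M\}$ is player $n$'s baseline action and $S_n\in\{C,D\}$ (content/discontent), so the state space is $\prod_{n=1}^N(\{1,\dots,M\}\times\{C,D\})$. In each step, players independently choose actions: a content player plays $a_n=\bar a_n$ with probability $1-\varepsilon^c$ and each other arm with probability $\frac{\varepsilon^c}{M-1}$; a discontent player plays each arm with probability $\frac1M$. Then, with $u_n=u_n(\boldsymbol a)$ for the played profile $\boldsymbol a$, each player independently updates: if $S_n=C$, $a_n=\bar a_n$ and $u_n>0$, the new state is $[\bar a_n,C]$; otherwise (i.e., $a_n\ne\bar a_n$ or $u_n=0$ or $S_n=D$) the new state is $[a_n,C]$ with probability $\frac{u_n}{u_{n,\max}}\varepsilon^{u_{n,\max}-u_n}$ and $[a_n,D]$ with the remaining probability. $P^\varepsilon$ denotes the resulting transition matrix. *)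

(* Defs.v *)
From mathcomp Require Import all_boot.
From Stdlib Require Import Reals.
Set Implicit Arguments. Unset Strict Implicit. Unset Printing Implicit Defensive.

Section GoT.
Variables (N M : nat) (mu : 'I_N -> 'I_M -> R).

Definition profile := {ffun 'I_N -> 'I_M}.

Definition eta_arm (a : profile) (i : 'I_M) : R :=
  if (1 < #|[set n | a n == i]|)%N then 0%R else 1%R.

Definition util (n : 'I_N) (a : profile) : R := (mu n (a n) * eta_arm a (a n))%R.

(* u_{n,max} = max_a u_n(a)   (u_n >= 0, so 0 is a harmless initial value) *)
Definition umax (n : 'I_N) : R := \big[Rmax/0%R]_(a : profile) util n a.

Definition welfare (a : profile) : R := \big[Rplus/0%R]_(n : 'I_N) util n a.

(* states: for each player (baseline action, content?) ; true = C, false = D *)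
Definition state := {ffun 'I_N -> 'I_M * bool}.

Definition act_prob (eps c : R) (s : 'I_M * bool) (k : 'I_M) : R :=
  if s.2 then
    (if k == s.1 then 1 - Rpower eps c else Rpower eps c / INR (M - 1))%R
  else (1 / INR M)%R.

Definition upd_prob (eps : R) (n : 'I_N) (s : 'I_M * bool) (a : profile)
    (s' : 'I_M * bool) : R :=
  let un := util n a in
  if s.2 && (a n == s.1) && (if Rlt_dec 0 un then true else false) then
    (if s' == (s.1, true) then 1 else 0)%R
  else
    let pC := (un / umax n * Rpower eps (umax n - un))%R in
    if s'.1 != a n then 0%R
    else if s'.2 then pC else (1 - pC)%R.

Definition GoT_P (eps c : R) (z z' : state) : R :=
  \big[Rplus/0%R]_(a : profile)
    (\big[Rmult/1%R]_(n : 'I_N) act_prob eps c (z n) (a n) *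
     \big[Rmult/1%R]_(n : 'I_N) upd_prob eps n (z n) a (z' n))%R.

Definition stationary (P : state -> state -> R) (pi : state -> R) : Prop :=
  (forall z, 0 <= pi z)%R /\
  \big[Rplus/0%R]_(z : state) pi z = 1%R /\
  (forall z', \big[Rplus/0%R]_(z : state) (pi z * P z z')%R = pi z').

End GoT.

(* Main.v *)
(* A stationary distribution [pi] satisfies [sum_z pi z * (P f - f) z = 0] for every test
   function [f]; two choices of [f] replace the usual spanning-tree argument.

   Call a state stable if all players are content on pairwise distinct arms; such a state
   is left with probability of order [eps ^ c], and every other state with probability of
   order 1. A unique maximizer [a*] of the welfare [W] is injective, for otherwise a
   colliding player could move to a free arm. The indicator of [z*] as test function
   balances the flow into [z*] from the states where nobody is content, at rate of order
   [eps ^ (sum umax - W a* )], with the flow out of [z*], at rate at most of order [eps ^ c];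
   hence [pi z <= A * eps ^ (c - (sum umax - W a* )) * pi z*] for each such state [z].

   Every other state is compared with these. For an injective profile [b], let [rho z] be
   the sum of [umax n - mu n (b n)] over the players [n] that are not content on [b n]. One
   step decreases [rho] by [x] with probability [O (eps ^ x)], and from every state with a
   content player a collision decreases the number of content players without decreasing
   [rho]. A function close to [(K * eps) ^ rho z] then decreases on average except where
   nobody is content. For the stable state [z_b] this gives
   [pi z_b <= A * eps ^ (W a* - W b) * pi z*]; for the unstable states [rho = 0] suffices. *)

Require Import Defs.
From HB Require Import structures.
From Stdlib Require Import Reals Lra.
From mathcomp Require Import all_boot.
Set Implicit Arguments. Unset Strict Implicit. Unset Printing Implicit Defensive.
Delimit Scope R_scope with R.
Local Open Scope R_scope.

(** * Big sums, big products and powers of reals *)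

HB.instance Definition _ := Monoid.isComLaw.Build R 0 Rplus
  (fun x y z => esym (Rplus_assoc x y z)) Rplus_comm Rplus_0_l.
HB.instance Definition _ := Monoid.isComLaw.Build R 1 Rmult
  (fun x y z => esym (Rmult_assoc x y z)) Rmult_comm Rmult_1_l.
HB.instance Definition _ := Monoid.isMulLaw.Build R 0 Rmult Rmult_0_l Rmult_0_r.
HB.instance Definition _ := Monoid.isAddLaw.Build R Rmult Rplus
  (fun x y z => Rmult_plus_distr_r x y z) Rmult_plus_distr_l.

Lemma RsumD1 (I : finType) (Q : pred I) (F : I -> R) (i : I) : Q i ->
  \big[Rplus/0]_(j | Q j) F j = F i + \big[Rplus/0]_(j | Q j && (j != i)) F j.
Proof. exact: bigD1. Qed.

Lemma Rsum_le (I : finType) (Q : pred I) (F G : I -> R) :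
  (forall i, Q i -> F i <= G i) ->
  \big[Rplus/0]_(i | Q i) F i <= \big[Rplus/0]_(i | Q i) G i.
Proof. by move=> FG; elim/big_rec2: _ => [|i x y Qi xy]; [lra | have := FG i Qi; lra]. Qed.

Lemma Rsum_ge0 (I : finType) (Q : pred I) (F : I -> R) :
  (forall i, Q i -> 0 <= F i) -> 0 <= \big[Rplus/0]_(i | Q i) F i.
Proof. by move=> F0; elim/big_rec: _ => [|i x Qi x0]; [lra | have := F0 i Qi; lra]. Qed.

Lemma Rsum_const (I : finType) (Q : pred I) (x : R) :
  \big[Rplus/0]_(i | Q i) x = INR #|Q| * x.
Proof.
rewrite big_const; elim: #|_| => [|n IH]; first by rewrite Rmult_0_l.
by rewrite iterS IH S_INR; lra.
Qed.

Lemma Rsum_le_card (I : finType) (Q : pred I) (F : I -> R) (x : R) :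
  0 <= x -> (forall i, Q i -> F i <= x) ->
  \big[Rplus/0]_(i | Q i) F i <= INR #|I| * x.
Proof.
move=> x0 Fx; apply: Rle_trans (Rsum_le Fx) _; rewrite Rsum_const.
by apply: Rmult_le_compat_r => //; apply/le_INR/leP/max_card.
Qed.

Lemma Rsum_ge_term (I : finType) (F : I -> R) (i : I) :
  (forall j, 0 <= F j) -> F i <= \big[Rplus/0]_j F j.
Proof.
move=> F0; rewrite (RsumD1 F (i := i)) //=.
by have := @Rsum_ge0 I (fun j => j != i) F (fun j _ => F0 j); lra.
Qed.

Lemma Rprod_ge0 (I : finType) (F : I -> R) :
  (forall i, 0 <= F i) -> 0 <= \big[Rmult/1]_i F i.
Proof. by move=> F0; elim/big_rec: _ => [|i x _ x0]; [lra | apply: Rmult_le_pos]. Qed.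

Lemma Rprod_gt0 (I : finType) (F : I -> R) :
  (forall i, 0 < F i) -> 0 < \big[Rmult/1]_i F i.
Proof. by move=> F0; elim/big_rec: _ => [|i x _ x0]; [lra | apply: Rmult_lt_0_compat]. Qed.

Lemma Rprod_le (I : finType) (Q : pred I) (F G : I -> R) :
  (forall i, Q i -> 0 <= F i <= G i) ->
  0 <= \big[Rmult/1]_(i | Q i) F i <= \big[Rmult/1]_(i | Q i) G i.
Proof.
move=> FG; elim/big_rec2: _ => [|i x y Qi [x0 xy]]; first lra.
have [F0 Fi] := FG i Qi; split; first exact: Rmult_le_pos.
exact: Rmult_le_compat.
Qed.

Lemma Rprod_const (n : nat) (x : R) : \big[Rmult/1]_(i < n) x = x ^ n.
Proof. by rewrite big_const_ord; elim: n => //= n ->. Qed.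

Lemma Rdiv_le1 (x y : R) : 0 < y -> x <= y -> x / y <= 1.
Proof.
move=> y0 xy; rewrite -(Rdiv_diag y); last lra.
by apply: Rmult_le_compat_r => //; apply/Rlt_le/Rinv_0_lt_compat.
Qed.

Lemma Rsum_sub (I : finType) (F G : I -> R) :
  \big[Rplus/0]_i (F i - G i) = \big[Rplus/0]_i F i - \big[Rplus/0]_i G i.
Proof.
suff <- : \big[Rplus/0]_i (F i - G i) + \big[Rplus/0]_i G i = \big[Rplus/0]_i F i by ring.
by rewrite -big_split; apply: eq_bigr => i _ /=; ring.
Qed.

Lemma Rprod_le1 (I : finType) (Q : pred I) (F : I -> R) :
  (forall i, 0 <= F i <= 1) -> \big[Rmult/1]_(i | Q i) F i <= 1.
Proof.
move=> F01; apply: Rle_trans (proj2 (Rprod_le (G := fun=> 1) (fun i _ => F01 i))) _.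
by rewrite big1_eq; lra.
Qed.

Lemma Rprod_le_term (I : finType) (F : I -> R) (i : I) :
  (forall j, 0 <= F j <= 1) -> 0 <= \big[Rmult/1]_j F j <= F i.
Proof.
move=> F01; rewrite (bigD1 i) //=.
have := @Rprod_le1 _ (fun j => j != i) _ F01; have := F01 i.
have : 0 <= \big[Rmult/1]_(j | j != i) F j.
  by apply: (proj1 (Rprod_le (G := F) _)) => j _; have := F01 j; lra.
by move: (\big[_/_]_(_ | _) _) => s; nra.
Qed.

Lemma le_Rmax_big (I : finType) (F : I -> R) (i : I) : F i <= \big[Rmax/0]_j F j.
Proof.
have : i \in index_enum I by rewrite mem_index_enum.
elim: (index_enum I) => // j s IH; rewrite inE big_cons => /orP[/eqP <-|/IH le].
  exact: Rmax_l.
exact: Rle_trans le (Rmax_r _ _).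
Qed.

Lemma Rpower_gt0 (x y : R) : 0 < Rpower x y.
Proof. exact: exp_pos. Qed.

Lemma Rpower_anti (e x y : R) : 0 < e <= 1 -> x <= y -> Rpower e y <= Rpower e x.
Proof.
move=> [e0 e1] xy.
have ln0 : ln e <= 0.
  by case: (Rle_lt_or_eq_dec _ _ e1) => [/(ln_increasing _ _ e0)|->]; rewrite ln_1; lra.
have : y * ln e <= x * ln e by nra.
case/Rle_lt_or_eq_dec => [/exp_increasing|E]; rewrite /Rpower; first lra.
by rewrite E; lra.
Qed.

Lemma Rpower_le1 (e x : R) : 0 < e <= 1 -> 0 <= x -> Rpower e x <= 1.
Proof. by move=> e01 x0; rewrite -(Rpower_O e); [apply: Rpower_anti | lra]. Qed.

Lemma Rpower_sum (I : finType) (e : R) (F : I -> R) : 0 < e ->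
  Rpower e (\big[Rplus/0]_i F i) = \big[Rmult/1]_i Rpower e (F i).
Proof.
move=> e0; apply: (big_morph (Rpower e)); last exact: Rpower_O.
by move=> x y; exact: Rpower_plus.
Qed.

(** * Properties of all sufficiently small positive reals *)

Definition near0 (Q : R -> Prop) : Prop :=
  exists e0, 0 < e0 /\ forall e, 0 < e < e0 -> Q e.

Lemma near0_and (Q1 Q2 : R -> Prop) :
  near0 Q1 -> near0 Q2 -> near0 (fun e => Q1 e /\ Q2 e).
Proof.
move=> [e1 [e1_gt0 H1]] [e2 [e2_gt0 H2]]; exists (Rmin e1 e2); split.
  exact: Rmin_pos.
move=> e [e_gt0 eM]; have := Rmin_l e1 e2; have := Rmin_r e1 e2.
by split; [apply: H1 | apply: H2]; lra.
Qed.

Lemma near0_sub (Q1 Q2 : R -> Prop) :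
  (forall e, 0 < e -> Q1 e -> Q2 e) -> near0 Q1 -> near0 Q2.
Proof.
move=> Q12 [e1 [e1_gt0 H1]]; exists e1; split=> // e e_in.
by apply: Q12; [case: e_in | exact: H1].
Qed.

Lemma near0_all (I : finType) (Q : I -> R -> Prop) :
  (forall i, near0 (Q i)) -> near0 (fun e => forall i, Q i e).
Proof.
move=> HQ.
have : near0 (fun e => forall i, i \in enum I -> Q i e).
  elim: (enum I) => [|i s IH]; first by exists 1; split; first lra.
  apply: near0_sub (near0_and (HQ i) IH) => e _ [Qi Qs] j.
  by rewrite inE => /orP[/eqP->|/Qs].
by apply: near0_sub => e _ H i; apply: H; rewrite mem_enum.
Qed.

Lemma near0_lt (t : R) : 0 < t -> near0 (fun e => e < t).
Proof. by move=> t0; exists t; split=> // e []. Qed.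

Lemma near0_Rpower (A d t : R) : 0 < A -> 0 < d -> 0 < t ->
  near0 (fun e => A * Rpower e d <= t).
Proof.
(* The threshold solves [A * e ^ d = t]. *)
move=> A0 d0 t0; exists (Rpower (t / A) (/ d)); split; first exact: Rpower_gt0.
move=> e [e0 e1].
have tA0 : 0 < t / A by apply: Rdiv_lt_0_compat.
have : Rpower e d <= Rpower (Rpower (t / A) (/ d)) d.
  by apply: Rle_Rpower_l; lra.
rewrite Rpower_mult Rinv_l; last lra.
rewrite Rpower_1 // => le_tA.
have -> : t = A * (t / A) by field; lra.
by apply: Rmult_le_compat_l; lra.
Qed.

(** * Lyapunov bounds for stationary distributions *)

Section MarkovChain.
Variables (S : finType) (P : S -> S -> R) (pi : S -> R).
Hypothesis P_ge0 : forall z z', 0 <= P z z'.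
Hypothesis P_sum1 : forall z, \big[Rplus/0]_z' P z z' = 1.
Hypothesis pi_ge0 : forall z, 0 <= pi z.
Hypothesis pi_inv : forall z', \big[Rplus/0]_z (pi z * P z z') = pi z'.

(** For a stochastic [P] this is [(P f - f) z]; written with differences, its term at [z' = z]
    vanishes. *)
Definition drift (f : S -> R) (z : S) : R :=
  \big[Rplus/0]_z' (P z z' * (f z' - f z)).

Lemma stationary_drift (f : S -> R) : \big[Rplus/0]_z (pi z * drift f z) = 0.
Proof.
have E z : pi z * drift f z =
    \big[Rplus/0]_z' (pi z * P z z' * f z') + - (pi z * f z).
  have -> : - (pi z * f z) = \big[Rplus/0]_z' (P z z' * - (pi z * f z)).
    by rewrite -big_distrl /= P_sum1 Rmult_1_l.
  rewrite -big_split /= big_distrr /=; apply: eq_bigr => z' _; ring.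
rewrite (eq_bigr _ (fun z _ => E z)) big_split /= exchange_big /=.
rewrite -big_split /= big1 // => z _.
by rewrite -big_distrl /= pi_inv; ring.
Qed.

(** In [stationary_drift] the negative term of [z0] must be offset by the other states, each of
    which contributes at most [Y]. *)
Lemma drift_bound (f : S -> R) (z0 : S) (b Y : R) :
  drift f z0 <= - b -> 0 <= Y ->
  (forall z, z != z0 -> pi z * drift f z <= Y) ->
  b * pi z0 <= INR #|S| * Y.
Proof.
move=> fz0 Y0 fY; have := stationary_drift f; rewrite (RsumD1 _ (i := z0)) //.
have : \big[Rplus/0]_(z | z != z0) (pi z * drift f z) <= INR #|S| * Y.
  exact: Rsum_le_card.
have := Rmult_le_compat_l _ _ _ (pi_ge0 z0) fz0.
by move: (\big[_/_]_(_ | _) _) => s; lra.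
Qed.

(** * A Lyapunov function built from a rank and a cost *)

Section Lyapunov.
(** In the game, [rk] counts the content players, [p] is the order of the probability of leaving a
    state, and [rho] is a settling cost or 0. The states of rank 0 are those with which all others
    are compared. *)
Variables (rk : S -> nat) (p rho : S -> R) (N : nat) (eps C kappa tau K Delta d : R).
Hypothesis rk_le : forall z, (rk z <= N)%N.
Hypothesis eps_gt0 : 0 < eps.
Hypothesis C_gt0 : 0 < C.
Hypothesis p_gt0 : forall z, 0 < p z.
Hypothesis P_le : forall z z', z' != z -> P z z' <= C * p z.
Hypothesis P_le_rho : forall z z', z' != z ->
  P z z' <= C * p z * Rpower eps (rho z - rho z').
Hypothesis P_down : forall z, (0 < rk z)%N ->
  exists z', [/\ (rk z' < rk z)%N, rho z <= rho z' & kappa * p z <= P z z'].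
Hypothesis rho_gap : forall z z', rho z' < rho z -> rho z' + Delta <= rho z.
Hypothesis rho_le : forall z, rho z <= d.
Hypothesis kappa_gt0 : 0 < kappa.
Hypothesis tau_in : 0 < tau < 1.
(** Multiplied by [tau ^ (k - 1)], this bounds [(#|S| * C + 2) * tau ^ k] by the gain of a move that
    leaves rank [k] downwards. The 2 pays once for the downward jumps of [rho], which [K_big] limits
    to [tau ^ N], and once for the negative drift that remains. *)
Hypothesis tau_small : (INR #|S| * C + 2) * tau <= kappa * (1 - tau).
Hypothesis K_ge1 : 1 <= K.
Hypothesis K_big : INR #|S| * C <= Rpower K Delta * tau ^ N.
Hypothesis Keps : K * eps <= 1.

Let phi z := Rpower (K * eps) (rho z).

(* The factor [K ^ rho z] makes the downward jumps of [rho], whose probability is only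
   just compensated by [eps ^ rho z], negligible; the factor [1 - tau ^ rk z] gains at the
   moves that decrease [rk] more than it can lose elsewhere. *)
Definition lyap (z : S) : R := Rpower (K * eps) (rho z) * (1 - tau ^ rk z).

Let tau_pow_gt0 n : 0 < tau ^ n.
Proof. by apply: pow_lt; lra. Qed.

Let tau_pow_le m n : (m <= n)%N -> tau ^ n <= tau ^ m.
Proof.
move=> /subnK <-; rewrite pow_add.
have : tau ^ (n - m) <= 1 by rewrite -(pow1 (n - m)); apply: pow_incr; lra.
by have := tau_pow_gt0 m; nra.
Qed.

Let phi_gt0 z : 0 < phi z.
Proof. exact: Rpower_gt0. Qed.

Let phi_le z z' : rho z <= rho z' -> phi z' <= phi z.
Proof. by move=> le; apply: Rpower_anti => //; split=> //; nra. Qed.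

Lemma lyap_ge0 z : 0 <= lyap z.
Proof.
apply: Rmult_le_pos; first exact: Rlt_le (phi_gt0 z).
by have := @tau_pow_le 0 (rk z) (leq0n _); rewrite /=; lra.
Qed.

Lemma lyap_le z : lyap z <= phi z.
Proof. by rewrite /lyap -/(phi z); have := phi_gt0 z; have := tau_pow_gt0 (rk z); nra. Qed.

(** If [rho] does not decrease, then [phi z' <= phi z] and only the deficit [phi z * tau ^ rk z] can
    be lost. If it decreases by [x >= Delta], the probability factor [eps ^ x] cancels the growth of
    [phi] in [eps] and leaves [K ^ (- x)]. *)
Lemma lyap_step_le z z' : z' != z ->
  P z z' * (lyap z' - lyap z) <= C * p z * phi z * (tau ^ rk z + Rpower K (- Delta)).
Proof.
move=> z'z; have := P_ge0 z z'; have := P_le z'z; have := P_le_rho z'z.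
set q := P z z' => q_rho q_le q0.
have pz := p_gt0 z; have Cp : 0 < C * p z by exact: Rmult_lt_0_compat.
have fz := phi_gt0 z; have tk := tau_pow_gt0 (rk z).
have KD := Rpower_gt0 K (- Delta).
case: (Rle_lt_dec (rho z) (rho z')) => [/phi_le le|lt].
  have d_le : lyap z' - lyap z <= phi z * tau ^ rk z.
    have lE : lyap z = phi z * (1 - tau ^ rk z) by [].
    by have := lyap_le z'; rewrite lE; lra.
  apply: (@Rle_trans _ (C * p z * (phi z * tau ^ rk z))).
    have f0 : 0 < phi z * tau ^ rk z by exact: Rmult_lt_0_compat.
    by nra.
  have : 0 < C * p z * phi z * Rpower K (- Delta) by do 2![apply: Rmult_lt_0_compat => //].
  by nra.
have le1 : q * (lyap z' - lyap z) <= q * phi z'.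
  by have := lyap_le z'; have := lyap_ge0 z; nra.
have E : Rpower eps (rho z - rho z') * phi z' = Rpower K (- (rho z - rho z')) * phi z.
  rewrite /phi -!Rpower_mult_distr; try lra.
  have -> : Rpower K (rho z') = Rpower K (- (rho z - rho z')) * Rpower K (rho z).
    by rewrite -Rpower_plus; congr (Rpower _ _); ring.
  have -> : Rpower eps (rho z) = Rpower eps (rho z - rho z') * Rpower eps (rho z').
    by rewrite -Rpower_plus; congr (Rpower _ _); ring.
  ring.
have KKD : Rpower K (- (rho z - rho z')) <= Rpower K (- Delta).
  by apply: Rle_Rpower => //; have := rho_gap lt; lra.
have fz' := phi_gt0 z'.
have : q * phi z' <= C * p z * (Rpower K (- Delta) * phi z).
  apply: (@Rle_trans _ (C * p z * Rpower eps (rho z - rho z') * phi z')).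
    by apply: Rmult_le_compat_r; lra.
  rewrite Rmult_assoc E; apply: Rmult_le_compat_l; first lra.
  by apply: Rmult_le_compat_r; lra.
have : 0 < C * p z * phi z * tau ^ rk z by do 2![apply: Rmult_lt_0_compat => //].
by nra.
Qed.

Lemma lyap_drift z : (0 < rk z)%N -> drift lyap z <= - (tau ^ N * p z * phi z).
Proof.
move=> rk0; have [zd [rkd rhod Pd]] := P_down rk0.
have zdz : zd != z by apply: contraTneq rkd => ->; rewrite ltnn.
rewrite /drift (RsumD1 _ (i := z)) // Rminus_diag Rmult_0_r Rplus_0_l (RsumD1 _ (i := zd)) //.
have pz := p_gt0 z; have fz := phi_gt0 z; have tk := tau_pow_gt0 (rk z).
have KD := Rpower_gt0 K (- Delta).
have X0 : 0 < C * p z * phi z * (tau ^ rk z + Rpower K (- Delta)).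
  by apply: Rmult_lt_0_compat; [do 2![apply: Rmult_lt_0_compat => //] | lra].
have : \big[Rplus/0]_(z' | (z' != z) && (z' != zd)) (P z z' * (lyap z' - lyap z)) <=
    INR #|S| * (C * p z * phi z * (tau ^ rk z + Rpower K (- Delta))).
  by apply: Rsum_le_card => [|z' /andP[z'z _]]; [lra | exact: lyap_step_le].
move: (\big[_/_]_(_ | _) _) => s Hs.
(* At [zd] the smaller rank lowers [1 - tau ^ rk], and [phi] does not grow because [rho] does not
   decrease. *)
have dd : P z zd * (lyap zd - lyap z) <= - (kappa * p z * phi z * (tau ^ (rk z).-1 - tau ^ rk z)).
  have tt : tau ^ rk z <= tau ^ (rk z).-1 by apply: tau_pow_le; exact: leq_pred.
  have : lyap zd - lyap z <= - (phi z * (tau ^ (rk z).-1 - tau ^ rk z)).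
    have : lyap zd <= phi z * (1 - tau ^ (rk z).-1).
      apply: Rmult_le_compat.
      - exact: Rlt_le (phi_gt0 zd).
      - by have := @tau_pow_le 0 (rk zd) (leq0n _); rewrite /=; lra.
      - exact: phi_le.
      - have : (rk zd <= (rk z).-1)%N by rewrite -ltnS prednK.
        by move/tau_pow_le; lra.
    by rewrite /lyap -/(phi z); lra.
  have f0 : 0 <= phi z * (tau ^ (rk z).-1 - tau ^ rk z) by apply: Rmult_le_pos; lra.
  have kp : 0 < kappa * p z by exact: Rmult_lt_0_compat.
  by nra.
have tE : tau ^ rk z = tau * tau ^ (rk z).-1 by rewrite -{1}(prednK rk0).
have t1 := tau_pow_gt0 (rk z).-1.
have tauk : (INR #|S| * C + 2) * tau ^ rk z <= kappa * (tau ^ (rk z).-1 - tau ^ rk z).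
  by rewrite tE; nra.
have KN : INR #|S| * C * Rpower K (- Delta) <= tau ^ N.
  have KK1 : Rpower K Delta * Rpower K (- Delta) = 1.
    by rewrite -Rpower_plus Rplus_opp_r Rpower_O //; lra.
  apply: Rle_trans (Rmult_le_compat_r _ _ _ (Rlt_le _ _ KD) K_big) _.
  rewrite (_ : _ * _ * _ = Rpower K Delta * Rpower K (- Delta) * tau ^ N); last ring.
  by rewrite KK1; lra.
have tN := tau_pow_le (rk_le z).
have pf : 0 < p z * phi z by exact: Rmult_lt_0_compat.
have : INR #|S| * C * (tau ^ rk z + Rpower K (- Delta)) + tau ^ N
   <= kappa * (tau ^ (rk z).-1 - tau ^ rk z) by lra.
move/(Rmult_le_compat_l _ _ _ (Rlt_le _ _ pf)).
by lra.
Qed.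

(** Meant for rank 0, where no rank-decreasing move is available. Only the landing value [phi z'] is
    kept; the jump probability turns its [eps ^ rho z'] into [eps ^ rho z], whatever [z'] is. *)
Lemma lyap_drift_le z : drift lyap z <= INR #|S| * (C * p z * Rpower K d * Rpower eps (rho z)).
Proof.
have pz := p_gt0 z.
have Kd := Rpower_gt0 K d; have er := Rpower_gt0 eps (rho z).
rewrite /drift (RsumD1 _ (i := z)) // Rminus_diag Rmult_0_r Rplus_0_l.
apply: Rsum_le_card => [|z' z'z]; first by do 3![apply: Rmult_le_pos; last lra]; lra.
have q0 := P_ge0 z z'; have q_rho := P_le_rho z'z.
have le1 : P z z' * (lyap z' - lyap z) <= P z z' * phi z'.
  by have := lyap_le z'; have := lyap_ge0 z; nra.
have fz' := phi_gt0 z'.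
apply: Rle_trans le1 _.
apply: (@Rle_trans _ (C * p z * Rpower eps (rho z - rho z') * phi z')).
  by apply: Rmult_le_compat_r; lra.
rewrite /phi -Rpower_mult_distr; try lra.
have -> : Rpower eps (rho z) = Rpower eps (rho z - rho z') * Rpower eps (rho z').
  by rewrite -Rpower_plus; congr (Rpower _ _); ring.
have KK : Rpower K (rho z') <= Rpower K d by apply: Rle_Rpower.
have : 0 < C * p z * Rpower eps (rho z - rho z') * Rpower eps (rho z').
  by do 3![apply: Rmult_lt_0_compat; last exact: Rpower_gt0 || exact: pz].
by nra.
Qed.

(** By [lyap_drift] only states of rank 0 can contribute positively to the balance, so they control
    the mass of every other state. *)
Lemma stationary_lyap (z0 : S) (Y : R) : (0 < rk z0)%N -> 0 <= Y ->
  (forall z, rk z = 0%N ->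
    pi z * (INR #|S| * (C * p z * Rpower K d * Rpower eps (rho z))) <= Y) ->
  tau ^ N * p z0 * phi z0 * pi z0 <= INR #|S| * Y.
Proof.
move=> z00 Y0 HY; apply: (drift_bound (lyap_drift z00)) => // z _.
have piz := pi_ge0 z.
case: (posnP (rk z)) => [rk0|/lyap_drift le].
  apply: Rle_trans (HY z rk0); apply: Rmult_le_compat_l => //.
  exact: lyap_drift_le.
have : 0 < tau ^ N * p z * phi z by do 2![apply: Rmult_lt_0_compat => //].
by nra.
Qed.

End Lyapunov.
End MarkovChain.

(** * The collision game and its dynamics *)

Section Game.
Variables (N M : nat) (mu : 'I_N -> 'I_M -> R).
Hypothesis N_ge2 : (2 <= N)%N.
Hypothesis N_le_M : (N <= M)%N.
Hypothesis mu_gt0 : forall n i, 0 < mu n i.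

Lemma util_collision (a : profile N M) (n m : 'I_N) : n != m -> a n = a m -> util mu n a = 0.
Proof.
move=> nm anm; rewrite /util /eta_arm ifT ?Rmult_0_r //.
rewrite -(_ : #|[set n; m]| = 2%N); last by rewrite cards2 nm.
by apply/subset_leq_card/subsetP => k /set2P[]->; rewrite inE ?anm.
Qed.

Lemma util_cases (a : profile N M) n : util mu n a = 0 \/ util mu n a = mu n (a n).
Proof. by rewrite /util /eta_arm; case: ifP => _; [left | right]; ring. Qed.

Lemma util_ge0 (a : profile N M) n : 0 <= util mu n a.
Proof. by have := mu_gt0 n (a n); case: (util_cases a n) => ->; lra. Qed.

Lemma util_inj (a : profile N M) n : injective a -> util mu n a = mu n (a n).
Proof.
move=> a_inj; rewrite /util /eta_arm (_ : [set m | _] = [set n]).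
  by rewrite cards1 /=; ring.
by apply/setP => m; rewrite !inE (inj_eq a_inj).
Qed.

Lemma util_le_umax (a : profile N M) n : util mu n a <= umax mu n.
Proof. exact: (le_Rmax_big (util mu n)). Qed.

Lemma mu_le_umax (a : profile N M) n : injective a -> mu n (a n) <= umax mu n.
Proof. by move=> a_inj; rewrite -util_inj //; exact: util_le_umax. Qed.

Lemma umax_gt0 n : 0 < umax mu n.
Proof.
(* Since [N <= M] there is an injective profile, and it gives every player a positive utility. *)
pose a : profile N M := [ffun k => widen_ord N_le_M k].
have a_inj : injective a.
  by move=> k l; rewrite !ffunE => /(congr1 val) /= kl; apply: val_inj.
exact: Rlt_le_trans (mu_gt0 n (a n)) (mu_le_umax n a_inj).
Qed.

(* If two players collide, some arm is free, and moving one of them there hurts nobody. *)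
Lemma maximizer_inj (a : profile N M) :
  (forall b, b <> a -> welfare mu b < welfare mu a) -> injective a.
Proof.
move=> a_max; apply/injectiveP; apply: contraT => /injectivePn[n [m nm anm]].
(* Because [m] shares the arm of [n], the arms of the players other than [n] are all the arms in
   use; there are at most [N - 1 < M] of them. *)
pose A := a @: [set~ n].
have a_in k : a k \in A.
  have [->|kn] := eqVneq k n; last by apply: imset_f; rewrite !inE.
  by rewrite anm; apply: imset_f; rewrite !inE eq_sym.
have : (#|A| < M)%N.
  apply: leq_ltn_trans (leq_imset_card _ _) _.
  rewrite cardsC1 card_ord; apply: leq_trans N_le_M.
  by rewrite prednK // (leq_trans _ N_ge2).
move=> A_lt; have /set0Pn[i] : ~: A != set0.
  by rewrite -card_gt0 -(ltn_add2l #|A|) cardsC addn0 card_ord.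
rewrite inE => iA.
have ai k : a k != i by apply: contraNneq iA => <-; exact: a_in.
pose b : profile N M := [ffun k => if k == n then i else a k].
have bn : b n = i by rewrite ffunE eqxx.
have ba : b <> a by move=> E; have := ai n; rewrite -E bn eqxx.
suff : welfare mu a <= welfare mu b by have := a_max b ba; lra.
apply: Rsum_le => k _; have [->|kn] := eqVneq k n.
  by rewrite (util_collision nm anm); exact: util_ge0.
have bk : b k = a k by rewrite ffunE (negbTE kn).
rewrite /util bk; apply: Rmult_le_compat_l; first exact: Rlt_le.
rewrite /eta_arm; have : (#|[set l | b l == a k]| <= #|[set l | a l == a k]|)%N.
  apply/subset_leq_card/subsetP => l; rewrite !inE ffunE.
  by case: ifP => // _ /eqP E; have := ai k; rewrite E eqxx.
case: ifP => [_ | a_le] le_ba; first by case: ifP => _; lra.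
by case: ifP => [/leq_trans/(_ le_ba) | _]; [rewrite a_le | lra].
Qed.

(* What it takes player [n] in state [s] to become content on [a n], as an exponent of
   [eps]. A player content on another arm is charged like a discontent one, because
   collisions make players discontent for free. *)
Definition cost (a : profile N M) (n : 'I_N) (s : 'I_M * bool) : R :=
  if s == (a n, true) then 0 else umax mu n - mu n (a n).

Definition settle_cost (a : profile N M) (z : state N M) : R :=
  \big[Rplus/0]_n cost a n (z n).

Lemma cost_bounds (a : profile N M) n s : injective a ->
  0 <= cost a n s <= umax mu n - mu n (a n).
Proof. by move=> /(mu_le_umax n) a_le; rewrite /cost; case: ifP => _; lra. Qed.

Definition content (z : state N M) : nat := #|[set n | (z n).2]|.

Definition stable (z : state N M) : bool :=
  [forall n, (z n).2] && injectiveb (fun n => (z n).1).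

(** * Bounds on the one-step transition probabilities *)

Section Dynamics.
Variables (eps c : R).
Hypothesis eps_in : 0 < eps < 1.
Hypothesis eps_c : Rpower eps c <= / 2.

(** An order of magnitude rather than an actual probability: up to constants it bounds every
    transition out of [z] from above, and the move of [content_drop] from below. *)
Definition leave_prob (z : state N M) : R := if stable z then Rpower eps c else 1.

Lemma leave_prob_gt0 z : 0 < leave_prob z.
Proof. by rewrite /leave_prob; case: ifP => _; [exact: Rpower_gt0 | lra]. Qed.

Let M_ge2 : (2 <= M)%N. Proof. exact: leq_trans N_le_M. Qed.

Let M_pos : 0 < INR M. Proof. exact/lt_0_INR/ltP/ltnW. Qed.

Let M1_ge1 : 1 <= INR (M - 1).
Proof. by rewrite -[1]/(INR 1); apply/le_INR/leP; rewrite subn_gt0. Qed.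

Let INR_M1 : INR M = INR (M - 1) + 1.
Proof. by rewrite -S_INR -subSn ?subn1 //; exact: ltnW. Qed.

Let e_gt0 : 0 < Rpower eps c. Proof. exact: Rpower_gt0. Qed.

Lemma act_prob_in (s : 'I_M * bool) k : 0 <= act_prob eps c s k <= 1.
Proof.
rewrite /act_prob; case: s.2; last first.
  split; first by apply: Rlt_le; apply: Rdiv_lt_0_compat; lra.
  by apply: Rdiv_le1; lra.
case: ifP => _; first lra.
split; first by apply: Rlt_le; apply: Rdiv_lt_0_compat; lra.
by apply: Rdiv_le1; lra.
Qed.

Lemma act_prob_explore (s : 'I_M * bool) k : s.2 -> k != s.1 ->
  act_prob eps c s k = Rpower eps c / INR (M - 1).
Proof. by rewrite /act_prob => -> /negbTE ->. Qed.

Lemma act_prob_sum (s : 'I_M * bool) : \big[Rplus/0]_k act_prob eps c s k = 1.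
Proof.
rewrite /act_prob; case: s.2; last first.
  by rewrite Rsum_const card_ord; field; lra.
rewrite (RsumD1 _ (i := s.1)) // eqxx.
rewrite (eq_bigr (fun=> Rpower eps c / INR (M - 1))); last first.
  by move=> k /andP[_ /negbTE ->].
rewrite Rsum_const cardC1 card_ord -subn1; field; lra.
Qed.

Definition accept_prob n (b : profile N M) : R :=
  util mu n b / umax mu n * Rpower eps (umax mu n - util mu n b).

Lemma accept_prob_in n b :
  0 <= accept_prob n b <= Rpower eps (umax mu n - util mu n b).
Proof.
have um := umax_gt0 n; have u0 := util_ge0 b n; have uu := util_le_umax b n.
have q0 := Rpower_gt0 eps (umax mu n - util mu n b).
have r0 : 0 <= util mu n b / umax mu n.
  by apply: Rmult_le_pos => //; apply/Rlt_le/Rinv_0_lt_compat.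
have r1 : util mu n b / umax mu n <= 1 by apply: Rdiv_le1; lra.
by rewrite /accept_prob; nra.
Qed.

Lemma accept_prob_le1 n b : accept_prob n b <= 1.
Proof.
apply: Rle_trans (accept_prob_in n b).2 _.
by apply: Rpower_le1; [lra | have := util_le_umax b n; lra].
Qed.

Lemma upd_prob_in n s b s' : 0 <= upd_prob mu eps n s b s' <= 1.
Proof.
rewrite /upd_prob; have := accept_prob_in n b; have := accept_prob_le1 n b.
rewrite /accept_prob.
by case: (_ && _ && _); case: ifP => _; [lra | lra | lra | case: ifP => _; lra].
Qed.

Lemma upd_prob_sum n s b : \big[Rplus/0]_s' upd_prob mu eps n s b s' = 1.
Proof.
rewrite /upd_prob; case: (_ && _ && _).
  rewrite (RsumD1 _ (i := (s.1, true))) // eqxx big1 => [|s' /andP[_ /negbTE -> //]]; ring.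
rewrite (RsumD1 _ (i := (b n, true))) // (RsumD1 _ (i := (b n, false))); last first.
  by rewrite xpair_eqE andbF.
rewrite big1 /= ?eqxx /=; first by ring.
by case=> k f /=; rewrite !xpair_eqE; case: eqP => //= _; case: f.
Qed.

(** The right side is at least 1 unless the cost decreases, that is, unless the player becomes
    content on [a n]. This requires playing [a n] and accepting: a collision is never accepted, and
    otherwise the acceptance factor is exactly [eps] to the cost. *)
Lemma upd_prob_le n s b s' (a : profile N M) : injective a ->
  upd_prob mu eps n s b s' <= Rpower eps (cost a n s - cost a n s').
Proof.
move=> a_inj; have eps1 : 0 < eps <= 1 by lra.
have le1 : cost a n s <= cost a n s' ->
    upd_prob mu eps n s b s' <= Rpower eps (cost a n s - cost a n s').
  move=> le; apply: Rle_trans (upd_prob_in n s b s').2 _.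
  by rewrite -(Rpower_O eps); [apply: Rpower_anti | ]; lra.
have cs := cost_bounds n s a_inj.
have [E|s'a] := eqVneq s' (a n, true); last by apply: le1; rewrite {2}/cost (negbTE s'a); lra.
have [ss'|ss'] := eqVneq s s'; first by apply: le1; rewrite ss'; lra.
rewrite {1}/cost -E (negbTE ss') {1}/cost E eqxx Rminus_0_r /upd_prob.
case: (boolP (_ && _ && _)) => [/andP[/andP[s2 _] _]|_] /=.
  have -> : ((a n, true) == (s.1, true)) = false.
    apply: contraNF ss' => /eqP[an]; rewrite E an -s2; by case: (s).
  exact: Rlt_le (Rpower_gt0 _ _).
have [an /=|_] := eqVneq (a n) (b n); last exact: Rlt_le (Rpower_gt0 _ _).
have := (accept_prob_in n b).2; rewrite /accept_prob.
case: (util_cases b n) => ->; last by rewrite an.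
by move=> _; rewrite /Rdiv !Rmult_0_l; exact: Rlt_le (Rpower_gt0 _ _).
Qed.

Local Notation P := (GoT_P mu eps c).

Lemma GoT_P_ge0 z z' : 0 <= P z z'.
Proof.
apply: Rsum_ge0 => b _; apply: Rmult_le_pos; apply: Rprod_ge0 => n.
  exact: (act_prob_in _ _).1.
exact: (upd_prob_in _ _ _ _).1.
Qed.

Lemma GoT_P_sum1 z : \big[Rplus/0]_z' P z z' = 1.
Proof.
rewrite exchange_big /=.
under eq_bigr => b _.
  rewrite -big_distrr /= -(bigA_distr_bigA (fun n s => upd_prob mu eps n (z n) b s)) /=.
  rewrite [X in _ * X]big1 => [|n _]; last exact: upd_prob_sum.
  rewrite Rmult_1_r; over.
rewrite -(bigA_distr_bigA (fun n s => act_prob eps c (z n) s)) /=.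
by apply: big1 => n _; exact: act_prob_sum.
Qed.

(** Only a stable [z] needs an argument. If somebody explores, the action probabilities contribute
    [eps ^ c]; if all play their baselines, nobody collides and the state cannot change. *)
Lemma step_prob_le (z z' : state N M) (b : profile N M) X : z' != z ->
  0 <= \big[Rmult/1]_n upd_prob mu eps n (z n) b (z' n) <= X ->
  \big[Rmult/1]_n act_prob eps c (z n) (b n) *
    \big[Rmult/1]_n upd_prob mu eps n (z n) b (z' n) <= leave_prob z * X.
Proof.
move=> z'z; set U := \big[_/_]_n upd_prob _ _ _ _ _ _; set A := \big[_/_]_n _ => -[U0 UX].
have act_in n : 0 <= act_prob eps c (z n) (b n) <= 1 by exact: act_prob_in.
have A0 : 0 <= A by apply: Rprod_ge0 => n; case: (act_in n).
rewrite /leave_prob; case: ifP => [st|_]; last first.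
  apply: Rmult_le_compat => //.
  have [n _|no] := pickP 'I_N; first exact: Rle_trans (Rprod_le_term n act_in).2 (act_in n).2.
  by rewrite /A big1 => [|n _]; [lra | have := no n].
case/andP: st => /forallP zC /injectiveP z_inj.
have [/existsP[n bn]|/existsPn base] := boolP [exists n, b n != (z n).1].
  apply: Rmult_le_compat => //.
  apply: Rle_trans (Rprod_le_term n act_in).2 _.
  rewrite act_prob_explore //; have iM : / INR (M - 1) <= 1.
    by rewrite -Rinv_1; apply: Rinv_le_contravar; lra.
  by rewrite /Rdiv; nra.
have bE n : b n = (z n).1 by apply/eqP; have := base n; rewrite negbK.
have b_inj : injective b by move=> n m; rewrite !bE => /z_inj.
have /existsP[n zn] : [exists n, z' n != z n].
  apply: contraNT z'z => /existsPn eq; apply/eqP/ffunP => n.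
  by apply/eqP; have := eq n; rewrite negbK.
suff -> : U = 0.
  rewrite Rmult_0_r; apply: Rmult_le_pos; lra.
rewrite /U (bigD1 n) //= /upd_prob zC bE eqxx util_inj //=.
case: Rlt_dec => [lt0 /=|le0]; last by case: le0; exact: mu_gt0.
rewrite (_ : (_ == _) = false) ?Rmult_0_l //.
by apply: contraNF zn => /eqP ->; rewrite -(zC n); case: (z n).
Qed.

Lemma GoT_P_le_aux (z z' : state N M) X : z' != z ->
  (forall b, \big[Rmult/1]_n upd_prob mu eps n (z n) b (z' n) <= X) ->
  P z z' <= INR #|profile N M| * leave_prob z * X.
Proof.
move=> z'z UX; rewrite Rmult_assoc -[#|_|]/#|{: profile N M}| -Rsum_const.
apply: Rsum_le => b _; apply: step_prob_le => //; split=> //.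
by apply: Rprod_ge0 => n; case: (upd_prob_in n (z n) b (z' n)).
Qed.

Lemma GoT_P_le (z z' : state N M) : z' != z -> P z z' <= INR #|profile N M| * leave_prob z.
Proof.
move=> z'z; rewrite -[leave_prob z]Rmult_1_r -Rmult_assoc; apply: GoT_P_le_aux => // b.
by apply: Rprod_le1 => n; exact: upd_prob_in.
Qed.

Lemma GoT_P_le_cost (a : profile N M) (z z' : state N M) : injective a -> z' != z ->
  P z z' <= INR #|profile N M| * leave_prob z * Rpower eps (settle_cost a z - settle_cost a z').
Proof.
move=> a_inj z'z; apply: GoT_P_le_aux => // b.
rewrite /settle_cost -Rsum_sub Rpower_sum; last lra.
apply: (Rprod_le _).2 => n _; split; first by case: (upd_prob_in n (z n) b (z' n)).
exact: upd_prob_le.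
Qed.

Lemma GoT_P_ge (z z' : state N M) (b : profile N M) :
  \big[Rmult/1]_n act_prob eps c (z n) (b n) *
    \big[Rmult/1]_n upd_prob mu eps n (z n) b (z' n) <= P z z'.
Proof.
pose F (b : profile N M) := \big[Rmult/1]_n act_prob eps c (z n) (b n) *
    \big[Rmult/1]_n upd_prob mu eps n (z n) b (z' n).
apply: (@Rsum_ge_term _ F b) => {}b; apply: Rmult_le_pos; apply: Rprod_ge0 => n.
  exact: (act_prob_in _ _).1.
exact: (upd_prob_in _ _ _ _).1.
Qed.

(* A profile in which everybody either sticks to a content baseline or collides leads
   deterministically to a state with no newly content player. *)
Lemma collision_step (z : state N M) (b : profile N M) n0 :
  (forall n, ((z n).2 /\ b n = (z n).1) \/ util mu n b = 0) ->
  (z n0).2 -> util mu n0 b = 0 ->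
  exists z', [/\ (content z' < content z)%N,
    forall a : profile N M, injective a -> settle_cost a z <= settle_cost a z'
    & \big[Rmult/1]_n act_prob eps c (z n) (b n) <= P z z'].
Proof.
move=> Hb zn0 un0.
pose keep n := (z n).2 && (b n == (z n).1) && (if Rlt_dec 0 (util mu n b) then true else false).
exists [ffun n => if keep n then z n else (b n, false)]; split.
- apply/proper_card/properP; split.
    by apply/subsetP => n; rewrite !inE ffunE; case: ifP => // /andP[/andP[]].
  exists n0; rewrite ?inE // ffunE /keep un0.
  by case: Rlt_dec => [/Rlt_irrefl //|nlt /=]; rewrite andbF.
- move=> a a_inj; apply: Rsum_le => n _; rewrite ffunE; case: ifP => _; first lra.
  by rewrite {2}/cost xpair_eqE andbF; case: (cost_bounds n (z n) a_inj).
- apply: Rle_trans (GoT_P_ge z _ b); rewrite -[X in X <= _]Rmult_1_r.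
  rewrite [X in _ <= _ * X]big1; first lra.
  move=> n _; rewrite ffunE /upd_prob -/(keep n); case: (boolP (keep n)) => [|kn].
    move=> /andP[/andP[z2 _] _]; rewrite (_ : _ == _) //.
    by rewrite -z2; case: (z n).
  rewrite /= eqxx /=; have [[z2 bn]|->] := Hb n; last by rewrite /Rdiv !Rmult_0_l Rminus_0_r.
  move: kn; rewrite /keep z2 bn eqxx; case: Rlt_dec => // un /= _.
  have -> : util mu n b = 0 by have := util_ge0 b n; lra.
  by rewrite /Rdiv !Rmult_0_l Rminus_0_r.
Qed.

(** A suitable collision is played with the required probability: each discontent player and each
    one sticking to a baseline contributes at least [/ (2 * INR M)]. Only in a stable state does the
    collision need an exploration, which costs one factor [eps ^ c]. *)
Lemma content_drop (z : state N M) : (0 < content z)%N ->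
  exists z', [/\ (content z' < content z)%N,
    forall a : profile N M, injective a -> settle_cost a z <= settle_cost a z'
    & (/ (2 * INR M)) ^ N * leave_prob z <= P z z'].
Proof.
move=> /card_gt0P[n1]; rewrite inE => zn1.
have kap : 0 < / (2 * INR M) by apply: Rinv_0_lt_compat; lra.
have kE : / (2 * INR M) = / 2 * / INR M by field; lra.
have M_inv : / INR M <= / 2.
  by apply: Rinv_le_contravar; [lra | rewrite INR_M1; lra].
have iM0 : 0 < / INR M by exact: Rinv_0_lt_compat.
have iM1 : / INR M <= / INR (M - 1) by apply: Rinv_le_contravar; lra.
have discontent_ge (s : 'I_M * bool) k : ~~ s.2 -> / (2 * INR M) <= act_prob eps c s k.
  by rewrite /act_prob => /negbTE ->; rewrite /Rdiv Rmult_1_l kE; lra.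
have base_ge (s : 'I_M * bool) : s.2 -> / (2 * INR M) <= act_prob eps c s s.1.
  by rewrite /act_prob => ->; rewrite eqxx kE; nra.
have explore_ge (s : 'I_M * bool) k : s.2 -> k != s.1 ->
    / (2 * INR M) * Rpower eps c <= act_prob eps c s k.
  by move=> s2 ks; rewrite act_prob_explore // kE; rewrite /Rdiv; nra.
have prod_ge (b : profile N M) :
    (forall n, / (2 * INR M) <= act_prob eps c (z n) (b n)) ->
    (/ (2 * INR M)) ^ N <= \big[Rmult/1]_n act_prob eps c (z n) (b n).
  move=> H; rewrite -Rprod_const.
  by apply: (Rprod_le _).2 => n _; split; [lra | exact: H].
have [st|nst] := boolP (stable z).
  case/andP: (st) => /forallP zC /injectiveP z_inj.
  have [m mn1] : exists m, m != n1.
    have : (0 < #|[set~ n1]|)%N by rewrite cardsC1 card_ord -subn1 subn_gt0.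
    by case/card_gt0P => m; rewrite !inE; exists m.
  pose b : profile N M := [ffun n => if n == n1 then (z m).1 else (z n).1].
  have bn1 : b n1 = (z m).1 by rewrite ffunE eqxx.
  have bm : b m = (z m).1 by rewrite ffunE (negbTE mn1).
  have un1 : util mu n1 b = 0.
    by apply: (@util_collision b n1 m); rewrite ?bn1 ?bm // eq_sym.
  have Hb n : ((z n).2 /\ b n = (z n).1) \/ util mu n b = 0.
    have [->|nn1] := eqVneq n n1; first by right.
    by left; split; [exact: zC | rewrite ffunE (negbTE nn1)].
  have [z' [lt le ge]] := collision_step Hb zn1 un1.
  exists z'; split=> //; apply: Rle_trans ge; rewrite /leave_prob st.
  (* Writing [eps ^ c] as a product with one nontrivial factor allows a comparison player by
     player. *)
  have <- : \big[Rmult/1]_n (if n == n1 then Rpower eps c else 1) = Rpower eps c.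
    by rewrite (bigD1 n1) //= eqxx big1 ?Rmult_1_r // => n /negbTE ->.
  rewrite -Rprod_const -big_split /=.
  apply: (Rprod_le _).2 => n _; case: eqP => [->|/eqP nn1]; last first.
    by rewrite ffunE (negbTE nn1) Rmult_1_r; split; [lra | exact: base_ge].
  split; first by apply: Rmult_le_pos; lra.
  by apply: explore_ge => //; rewrite bn1; apply: contraNneq mn1 => /z_inj ->.
rewrite /leave_prob (negbTE nst) Rmult_1_r.
(* Some content player [n0] suffers a collision when all content players stick to their
   baselines and all discontent ones play the baseline of [n0]. *)
have [n0 zn0 [m mn0 Hm]] : exists2 n0, (z n0).2 &
    exists2 m, m != n0 & ~~ (z m).2 \/ (z m).1 = (z n0).1.
  (* An unstable state has a discontent player or two players with equal baselines. In the second
     case, if the first of the two is discontent, the content player [n1] collides with it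
     instead. *)
  move: nst; rewrite negb_and => /orP[/forallPn[m zm]|/injectivePn[n [m nm E]]].
    by exists n1 => //; exists m; [apply: contraNneq zm => -> | left].
  have [zn|zn] := boolP (z n).2; first by exists n => //; exists m; [rewrite eq_sym | right].
  by exists n1 => //; exists n; [apply: contraNneq zn => -> | left].
pose b : profile N M := [ffun n => if (z n).2 then (z n).1 else (z n0).1].
have bn0 : b n0 = (z n0).1 by rewrite ffunE zn0.
have bm : b m = (z n0).1 by rewrite ffunE; case: Hm => [/negbTE ->|->] //; case: ifP.
have un0 : util mu n0 b = 0.
  by apply: (@util_collision b n0 m); rewrite ?bn0 ?bm // eq_sym.
have Hb n : ((z n).2 /\ b n = (z n).1) \/ util mu n b = 0.
  have [zn|zn] := boolP (z n).2; first by left; rewrite ffunE zn.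
  right; apply: (@util_collision b n n0); first by apply: contraNneq zn => ->.
  by rewrite bn0 ffunE (negbTE zn).
have [z' [lt le ge]] := collision_step Hb zn0 un0.
exists z'; split=> //; apply: Rle_trans ge; apply: prod_ge => n; rewrite ffunE.
by case: (boolP (z n).2) => zn; [exact: base_ge | exact: discontent_ge].
Qed.

Lemma welfare_gap (a : profile N M) : injective a ->
  \big[Rplus/0]_n umax mu n - welfare mu a = \big[Rplus/0]_n (umax mu n - mu n (a n)).
Proof.
by move=> a_inj; rewrite /welfare -Rsum_sub; apply: eq_bigr => n _; rewrite util_inj.
Qed.

Lemma settle_cost_bounds (a : profile N M) (z : state N M) : injective a ->
  0 <= settle_cost a z <= \big[Rplus/0]_n umax mu n - welfare mu a.
Proof.
move=> a_inj; rewrite welfare_gap //.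
split; [apply: Rsum_ge0 | apply: Rsum_le] => n _.
  exact: (cost_bounds n (z n) a_inj).1.
exact: (cost_bounds n (z n) a_inj).2.
Qed.

Lemma settle_cost_discontent (a : profile N M) (z : state N M) : injective a ->
  content z = 0%N -> settle_cost a z = \big[Rplus/0]_n umax mu n - welfare mu a.
Proof.
move=> a_inj /eqP; rewrite cards_eq0 => /eqP z0.
rewrite welfare_gap //; apply: eq_bigr => n _; rewrite /cost.
have : (z n).2 = false by have := in_set0 n; rewrite -z0 inE.
by case: eqP => // ->.
Qed.

Lemma settle_cost_content (a : profile N M) : settle_cost a [ffun n => (a n, true)] = 0.
Proof. by apply: big1 => n _; rewrite ffunE /cost eqxx. Qed.

(** When nobody is content, each profile is played with probability [(/ INR M) ^ N], and the
    exponents of the individual acceptances add up to the welfare gap. *)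
Lemma discontent_jump (a : profile N M) (z : state N M) : content z = 0%N ->
  (/ INR M) ^ N * \big[Rmult/1]_n (util mu n a / umax mu n) *
    Rpower eps (\big[Rplus/0]_n umax mu n - welfare mu a)
    <= P z [ffun n => (a n, true)].
Proof.
move=> /eqP; rewrite cards_eq0 => /eqP z0.
have zD n : (z n).2 = false by have := in_set0 n; rewrite -z0 inE.
apply: Rle_trans (GoT_P_ge z _ a); rewrite Rmult_assoc; apply: Req_le; congr (_ * _).
  rewrite -Rprod_const; apply: eq_bigr => n _.
  by rewrite /act_prob zD /Rdiv Rmult_1_l.
rewrite /welfare -Rsum_sub Rpower_sum; last lra.
rewrite -big_split /=; apply: eq_bigr => n _.
by rewrite /upd_prob ffunE zD /= eqxx.
Qed.

End Dynamics.
End Game.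

(** Only finitely many pairs have to be separated. This supplies the [Delta] of [rho_gap]. *)
Lemma finite_gap (T : finType) (f : T -> R) :
  exists2 Delta, 0 < Delta & forall x y, f y < f x -> f y + Delta <= f x.
Proof.
have [xy|e0 [e0_gt0 He0]] := @near0_all (T * T)%type
  (fun xy e => f xy.2 < f xy.1 -> f xy.2 + e <= f xy.1).
  have [lt|ge] := Rlt_dec (f xy.2) (f xy.1); last by exists 1; split; [lra | move=> e _ /ge].
  by exists (f xy.1 - f xy.2); split=> [|e]; lra.
by exists (e0 / 2) => [|x y lt]; [lra | apply: (He0 (e0 / 2) _ (x, y)) => //; lra].
Qed.

(** * Stochastic stability of the welfare maximizer *)

Section Stability.
Variables (N M : nat) (mu : 'I_N -> 'I_M -> R) (c : R).
Hypothesis N_ge2 : (2 <= N)%N.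
Hypothesis N_le_M : (N <= M)%N.
Hypothesis mu_gt0 : forall n i, 0 < mu n i.
Hypothesis c_gt0 : 0 < c.

Let S := INR #|state N M|.
Let C := INR #|profile N M|.

Let i0 : 'I_M. Proof. exact: Ordinal (leq_trans (ltnW N_ge2) N_le_M). Qed.

Let S_gt0 : 0 < S.
Proof. by apply/lt_0_INR/ltP/card_gt0P; exists [ffun=> (i0, true)]. Qed.

Let C_gt0 : 0 < C.
Proof. by apply/lt_0_INR/ltP/card_gt0P; exists [ffun=> i0]. Qed.

Let M_gt0 : 0 < INR M.
Proof. by apply/lt_0_INR/ltP; exact: leq_trans (ltnW N_ge2) N_le_M. Qed.

Lemma near0_regime :
  near0 (fun eps => 0 < eps < 1 /\ Rpower eps c <= / 2).
Proof.
have half : 0 < / 2 by lra.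
apply: near0_sub (near0_and (near0_lt Rlt_0_1) (near0_Rpower Rlt_0_1 c_gt0 half)).
by move=> e e0 [e1]; rewrite Rmult_1_l.
Qed.

Lemma stable_content (z : state N M) : stable z -> content z = N.
Proof.
case/andP=> /forallP zC _; rewrite /content (_ : [set n | _] = setT) ?cardsT ?card_ord //.
by apply/setP => n; rewrite !inE zC.
Qed.

(** Neither [tau] nor [K] depends on [eps], so [stationary_lyap] yields one constant [A] for all
    small [eps]. The bound [X] will come from [discontent_bound]; [rho] stays a parameter because it
    is used both as 0 and as a settling cost. *)
Lemma stationary_bound (rho : state N M -> R) (d : R) :
  (forall z, 0 <= rho z <= d) ->
  (forall z, content z = 0%N -> rho z = d) ->
  (forall eps, 0 < eps < 1 -> Rpower eps c <= / 2 ->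
    (forall z z', z' != z ->
      GoT_P mu eps c z z' <= C * leave_prob eps c z * Rpower eps (rho z - rho z')) /\
    (forall z, (0 < content z)%N -> exists z',
      [/\ (content z' < content z)%N, rho z <= rho z'
        & (/ (2 * INR M)) ^ N * leave_prob eps c z <= GoT_P mu eps c z z'])) ->
  exists2 A, 0 < A & near0 (fun eps => forall pi, stationary (GoT_P mu eps c) pi ->
    forall X, 0 <= X -> (forall z, content z = 0%N -> pi z <= X) ->
    forall z, (0 < content z)%N ->
      leave_prob eps c z * Rpower eps (rho z) * pi z <= A * X * Rpower eps d).
Proof.
move=> rho_in rho0 Hrho.
have [Delta Delta0 gap] := finite_gap rho.
set kappa := (/ (2 * INR M)) ^ N.
have kappa0 : 0 < kappa by apply/pow_lt/Rinv_0_lt_compat; lra.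
have SC : 0 < S * C by exact: Rmult_lt_0_compat.
(* This is the value with equality in [tau_small]. *)
pose tau := kappa / (S * C + 2 + kappa).
have tau_eq : tau * (S * C + 2 + kappa) = kappa by rewrite /tau; field; lra.
have tau_in : 0 < tau < 1 by split; [apply: Rdiv_lt_0_compat; lra | nra].
have tauN : 0 < tau ^ N by apply: pow_lt; lra.
(* [K] is determined by [K ^ Delta = B]. The quotient in [B] gives [K_big], the added 1 gives
   [K_ge1]. *)
pose B := (S * C) / tau ^ N + 1.
have B1 : 1 <= B by rewrite /B; have := Rdiv_lt_0_compat _ _ SC tauN; lra.
pose K := Rpower B (/ Delta).
have K1 : 1 <= K.
  rewrite -(Rpower_O B); last lra.
  by apply: Rle_Rpower => //; apply/Rlt_le/Rinv_0_lt_compat.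
have KD : Rpower K Delta = B by rewrite /K Rpower_mult Rinv_l ?Rpower_1; lra.
have KB : S * C <= Rpower K Delta * tau ^ N.
  by rewrite KD /B Rmult_plus_distr_r /Rdiv Rmult_assoc Rinv_l; lra.
have Kd := Rpower_gt0 K d.
exists (S * (S * (C * Rpower K d)) / tau ^ N).
  by apply: Rdiv_lt_0_compat => //; do 3![apply: Rmult_lt_0_compat => //].
have iK : 0 < / K by apply: Rinv_0_lt_compat; lra.
apply: near0_sub (near0_and near0_regime (near0_lt iK)).
move=> eps eps0 [[eps_in eps_c] epsK] pi [pi0 [pi1 piP]] X X0 HX z z0.
have [Hle Hdown] := Hrho eps eps_in eps_c.
have Keps : K * eps <= 1.
  by have := Rmult_lt_compat_l K _ _ (Rlt_le_trans _ _ _ Rlt_0_1 K1) epsK; rewrite Rinv_r; lra.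
have tau_small : (INR #|state N M| * C + 2) * tau <= kappa * (1 - tau) by rewrite -/S; lra.
have ct_le (y : state N M) : (content y <= N)%N.
  by rewrite -[X in (_ <= X)%N]card_ord; exact: max_card.
have ed := Rpower_gt0 eps d.
have Y0 : 0 <= X * (S * (C * Rpower K d * Rpower eps d)).
  by apply: Rmult_le_pos => //; apply/Rlt_le; do 3![apply: Rmult_lt_0_compat => //].
have Pge0 := GoT_P_ge0 N_ge2 N_le_M mu_gt0 eps_in eps_c.
have Psum := GoT_P_sum1 mu N_ge2 N_le_M c eps_in.
have Ple := fun z z' => @GoT_P_le _ _ _ N_ge2 N_le_M mu_gt0 _ _ eps_in eps_c z z'.
have := @stationary_lyap _ _ _ Pge0 Psum pi0 piP (@content N M) _ _ N eps C kappa tau K Delta d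
  ct_le eps0 C_gt0 (leave_prob_gt0 eps c) Ple Hle Hdown gap (fun z => (rho_in z).2)
  kappa0 tau_in tau_small K1 KB Keps z _ z0 Y0.
have HY y : content y = 0%N ->
    pi y * (S * (C * leave_prob eps c y * Rpower K d * Rpower eps (rho y))) <=
    X * (S * (C * Rpower K d * Rpower eps d)).
  move=> y0; rewrite rho0 // /leave_prob; case: ifP => [/stable_content|_].
    by rewrite y0 => N0; move: N_ge2; rewrite -N0.
  rewrite Rmult_1_r; apply: Rmult_le_compat_r (HX y y0).
  by apply/Rlt_le; do 3![apply: Rmult_lt_0_compat => //].
move=> /(_ HY) main.
have lp := leave_prob_gt0 eps c z.
have piz := pi0 z.
(* As [K >= 1] and [rho z >= 0], the factor [K ^ rho z] may be dropped. *)
have Krho : Rpower eps (rho z) <= Rpower (K * eps) (rho z).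
  by apply: Rle_Rpower_l; [case: (rho_in z) | nra].
set L := _ * pi z.
have L_le : tau ^ N * L <= S * (X * (S * (C * Rpower K d * Rpower eps d))).
  apply: Rle_trans main; rewrite /L -!Rmult_assoc; apply: Rmult_le_compat_r => //.
  by apply: Rmult_le_compat_l => //; apply/Rlt_le/Rmult_lt_0_compat.
have -> : S * (S * (C * Rpower K d)) / tau ^ N * X * Rpower eps d =
    / tau ^ N * (S * (X * (S * (C * Rpower K d * Rpower eps d)))).
  by rewrite /Rdiv; ring.
rewrite (_ : L = / tau ^ N * (tau ^ N * L)); last by field; lra.
by apply: Rmult_le_compat_l => //; apply/Rlt_le/Rinv_0_lt_compat.
Qed.

(** * Comparison of every state with the welfare maximizer *)

Section Maximizer.
Variable a : profile N M.
Hypothesis a_max : forall b, b <> a -> welfare mu b < welfare mu a.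

Local Notation zstar := ([ffun n => (a n, true)] : state N M).
Local Notation gap b := (\big[Rplus/0]_n umax mu n - welfare mu b).

Let a_inj : injective a := maximizer_inj N_ge2 N_le_M mu_gt0 a_max.

Lemma stable_zstar : stable zstar.
Proof.
apply/andP; split; first by apply/forallP => n; rewrite ffunE.
by apply/injectiveP => n m; rewrite !ffunE => /a_inj.
Qed.

Lemma discontent_bound :
  exists2 A, 0 < A & near0 (fun eps => forall pi, stationary (GoT_P mu eps c) pi ->
    forall z, content z = 0%N -> pi z <= A * Rpower eps (c - gap a) * pi zstar).
Proof.
pose kappa := (/ INR M) ^ N * \big[Rmult/1]_n (util mu n a / umax mu n).
have kappa0 : 0 < kappa.
  apply: Rmult_lt_0_compat; first by apply/pow_lt/Rinv_0_lt_compat.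
  apply: Rprod_gt0 => n; rewrite util_inj //.
  by apply: Rdiv_lt_0_compat; [exact: mu_gt0 | exact: umax_gt0].
exists (S * (S * C) / kappa).
  by apply: Rdiv_lt_0_compat => //; do 2![apply: Rmult_lt_0_compat => //].
apply: near0_sub near0_regime => eps eps0 [eps_in eps_c] pi [pi0 [_ piP]] z zD.
have Pge0 := GoT_P_ge0 N_ge2 N_le_M mu_gt0 eps_in eps_c.
have Psum := GoT_P_sum1 mu N_ge2 N_le_M c eps_in.
(* With the negative indicator of [zstar], every other state has nonpositive drift, so the outflow
   from [zstar] is the only positive term. *)
pose f (y : state N M) := if y == zstar then -1 else 0.
have z_neq : z != zstar.
  by apply/eqP => E; move: N_ge2; rewrite -(stable_content stable_zstar) -E zD.
have drift_f y : y != zstar -> drift (GoT_P mu eps c) f y = - GoT_P mu eps c y zstar.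
  move=> yz; rewrite /drift (RsumD1 _ (i := zstar)) // big1 => [|y' /andP[_ y'z]].
    by rewrite /f eqxx (negbTE yz); ring.
  by rewrite /f (negbTE yz) (negbTE y'z); ring.
have e_gt0 := Rpower_gt0 eps c.
have Y0 : 0 <= pi zstar * (S * (C * Rpower eps c)).
  by apply: Rmult_le_pos => //; apply/Rlt_le; do 2![apply: Rmult_lt_0_compat => //].
have fz : drift (GoT_P mu eps c) f z <= - (kappa * Rpower eps (gap a)).
  by rewrite drift_f //; apply: Ropp_le_contravar; exact: discontent_jump.
have := @drift_bound _ _ _ Psum pi0 piP f z _ _ fz Y0.
have HY y : y != z -> pi y * drift (GoT_P mu eps c) f y <= pi zstar * (S * (C * Rpower eps c)).
  have [->|yz] := eqVneq y zstar => _; last first.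
    apply: Rle_trans Y0; rewrite drift_f //.
    by have := pi0 y; have := Pge0 y zstar; nra.
  apply: Rmult_le_compat_l => //; rewrite /drift (RsumD1 _ (i := zstar)) //.
  rewrite Rminus_diag Rmult_0_r Rplus_0_l; apply: Rsum_le_card => [|y' y'z].
    by apply/Rlt_le/Rmult_lt_0_compat.
  have := GoT_P_le N_ge2 N_le_M mu_gt0 eps_in eps_c y'z.
  by rewrite /leave_prob stable_zstar /f eqxx (negbTE y'z) -/C; lra.
move=> /(_ HY) main.
have g_gt0 := Rpower_gt0 eps (gap a).
have e_split : Rpower eps c = Rpower eps (c - gap a) * Rpower eps (gap a).
  by rewrite -Rpower_plus; congr (Rpower _ _); ring.
have kg : 0 < kappa * Rpower eps (gap a) by exact: Rmult_lt_0_compat.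
apply: (Rmult_le_reg_l _ _ _ kg); apply: Rle_trans main _; rewrite e_split -/S.
by apply: Req_le; field; lra.
Qed.

Hypothesis c_big : c > gap a.

(** The ratio to [pi zstar] is a constant times a positive power of [eps]. The exponent is
    [c - gap a] for states without content players, and also, taking [rho = 0], for unstable ones.
    For a stable state on [b] it is [gap b - gap a], the welfare lost by [b]. *)
Lemma negligible (s : R) (z : state N M) : 0 < s -> z != zstar ->
  near0 (fun eps => forall pi, stationary (GoT_P mu eps c) pi -> pi z <= s * pi zstar).
Proof.
move=> s0 zz; have [A A0 HA] := discontent_bound.
have c0 : 0 < c - gap a by lra.
have [zD|zC] := posnP (content z).
  apply: near0_sub (near0_and HA (near0_Rpower A0 c0 s0)) => eps eps0 [H le] pi st.
  apply: Rle_trans (H pi st z zD) _; apply: Rmult_le_compat_r le; exact: st.1.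
have [st|nst] := boolP (stable z); last first.
  have [||eps eps_in eps_c|B B0 HB] := @stationary_bound (fun=> 0) 0; try by move=> *; lra.
    split=> [y y' y'y|y yC].
      rewrite Rminus_diag Rpower_O; last by case: eps_in.
      by rewrite Rmult_1_r; exact: GoT_P_le.
    have [y' [lt _ ge]] := content_drop N_ge2 N_le_M mu_gt0 eps_in eps_c yC.
    by exists y'; split=> //; lra.
  have BA : 0 < B * A by exact: Rmult_lt_0_compat.
  apply: near0_sub (near0_and HA (near0_and HB (near0_Rpower BA c0 s0))).
  move=> eps eps0 [H1 [H2 le]] pi st.
  have p0 : 0 <= pi zstar := st.1 zstar.
  have X0 : 0 <= A * Rpower eps (c - gap a) * pi zstar.
    by apply: Rmult_le_pos => //; apply/Rlt_le/Rmult_lt_0_compat => //; exact: Rpower_gt0.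
  have := H2 pi st _ X0 (H1 pi st) z zC.
  rewrite /leave_prob (negbTE nst) Rpower_O // !Rmult_1_l Rmult_1_r => bd.
  by apply: Rle_trans bd _; rewrite -!Rmult_assoc; apply: Rmult_le_compat_r.
case/andP: st (st) => /forallP z_content /injectiveP z_inj st.
pose b : profile N M := [ffun n => (z n).1].
have zE : z = [ffun n => (b n, true)].
  by apply/ffunP => n; rewrite !ffunE -(z_content n); case: (z n).
have b_inj : injective b by move=> n m; rewrite !ffunE => /z_inj.
have ba : b <> a by move=> E; move: zz; rewrite zE E eqxx.
have d0 : 0 < gap b - gap a by have := a_max ba; lra.
have [||eps eps_in eps_c|B B0 HB] := @stationary_bound (settle_cost mu b) (gap b).
- by move=> y; exact: settle_cost_bounds.
- by move=> y; exact: settle_cost_discontent.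
- split=> [y y' y'y|y yC]; first exact: GoT_P_le_cost.
  have [y' [lt le ge]] := content_drop N_ge2 N_le_M mu_gt0 eps_in eps_c yC.
  by exists y'; split=> //; exact: le.
have BA : 0 < B * A by exact: Rmult_lt_0_compat.
apply: near0_sub (near0_and HA (near0_and HB (near0_Rpower BA d0 s0))).
move=> eps eps0 [H1 [H2 le]] pi pi_st.
have p0 : 0 <= pi zstar := pi_st.1 zstar.
have X0 : 0 <= A * Rpower eps (c - gap a) * pi zstar.
  by apply: Rmult_le_pos => //; apply/Rlt_le/Rmult_lt_0_compat => //; exact: Rpower_gt0.
have := H2 pi pi_st _ X0 (H1 pi pi_st) z zC.
have -> : settle_cost mu b z = 0 by rewrite zE settle_cost_content.
rewrite /leave_prob st Rpower_O // Rmult_1_r => bd.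
have e_gt0 := Rpower_gt0 eps c.
apply: (Rmult_le_reg_l _ _ _ e_gt0); apply: Rle_trans bd _.
(* The exponents are regrouped so that the [eps ^ c] from leaving a stable state cancels. *)
have -> : B * (A * Rpower eps (c - gap a) * pi zstar) * Rpower eps (gap b) =
    Rpower eps c * (B * A * Rpower eps (gap b - gap a) * pi zstar).
  have E : Rpower eps (c - gap a) * Rpower eps (gap b) =
      Rpower eps c * Rpower eps (gap b - gap a).
    by rewrite -!Rpower_plus; congr (Rpower _ _); ring.
  rewrite (_ : _ * _ = B * A * pi zstar * (Rpower eps (c - gap a) * Rpower eps (gap b))); last ring.
  by rewrite E; ring.
apply: Rmult_le_compat_l; first lra.
exact: Rmult_le_compat_r.
Qed.

End Maximizer.
End Stability.

Theorem theorem2 (N M : nat) (mu : 'I_N -> 'I_M -> R)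
  (astar : profile N M) (c : R) :
  (2 <= N)%N -> (N <= M)%N ->
  (forall n i, (0 < mu n i)%R) ->
  (forall a : profile N M, a <> astar -> (welfare mu a < welfare mu astar)%R) ->
  (0 < c)%R ->
  (c > \big[Rplus/0%R]_(n : 'I_N) umax mu n - welfare mu astar)%R ->
  forall eta : R, (0 < eta < 1/2)%R ->
  exists eps0 : R, (0 < eps0)%R /\
    forall eps : R, (0 < eps < eps0)%R -> (eps < 1)%R ->
    forall pi : state N M -> R,
      stationary (GoT_P mu eps c) pi ->
      (pi [ffun n => (astar n, true)] > 1 / (2 * (1 - eta)))%R.
Proof.
move=> N_ge2 N_le_M mu_gt0 a_max c_gt0 c_big eta [eta0 eta1].
pose zs : state N M := [ffun n => (astar n, true)].
have S0 : 0 < INR #|state N M| by apply/lt_0_INR/ltP/card_gt0P; exists zs.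
(* With this [s] all states other than [zs] together have mass at most [(1 / 2 - eta) * pi zs]. *)
pose s := (1 / 2 - eta) / INR #|state N M|.
have s0 : 0 < s by apply: Rdiv_lt_0_compat; lra.
have [z|eps0 [eps0_gt0 H]] := @near0_all (state N M) (fun z eps => z != zs ->
    forall pi, stationary (GoT_P mu eps c) pi -> pi z <= s * pi zs).
  have [->|zz] := eqVneq z zs; first by exists 1; split; [lra | by move=> eps _ /eqP].
  apply: near0_sub (negligible N_ge2 N_le_M mu_gt0 c_gt0 a_max c_big s0 zz).
  by move=> eps _ h _.
exists eps0; split=> // eps /H small _ pi st.
have [pi0 [pi1 _]] := st; rewrite -/zs; have p0 : 0 <= pi zs := pi0 zs.
have sum_le : \big[Rplus/0]_(z | z != zs) pi z <= INR #|state N M| * (s * pi zs).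
  by apply: Rsum_le_card => [|z zz]; [apply: Rmult_le_pos; lra | exact: small].
move: pi1; rewrite (RsumD1 _ (i := zs)) // => pi1.
have Ss : INR #|state N M| * s = 1 / 2 - eta by rewrite /s; field; lra.
rewrite -Rmult_assoc Ss in sum_le.
have ge1 : 1 <= pi zs * (3 / 2 - eta).
  by rewrite -{1}pi1; move: sum_le; move: (\big[_/_]_(_ | _) _) => t; lra.
(* The strict inequality comes from [3 / 2 - eta < 2 * (1 - eta)], which is [eta < 1 / 2]. *)
apply: (Rmult_lt_reg_r (2 * (1 - eta))); first lra.
by rewrite /Rdiv Rmult_1_l Rinv_l; nra.
Qed.
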